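(* Let $U$ be a cancellative monoid with least common left multiples and let $A$ be a group. Let $A\times U\to U$, $(\alpha,u)\mapsto\alpha\cdot u$, and $A\times U\to A$, $(\alpha,u)\mapsto\alpha^u$, be functions (defined on all of $A\times U$) satisfying, for all $\alpha,\beta\in A$ and $u,v\in U$, $$(\alpha\beta)\cdot u=\alpha\cdot(\beta\cdot u),\quad (\alpha\beta)^u=\alpha^{\beta\cdot u}\beta^u,\quad \alpha\cdot(uv)=(\alpha\cdot u)(\alpha^u\cdot v),\quad \alpha^{uv}=(\alpha^u)^v,$$ $$\alpha^{1}=\alpha,\quad 1\cdot u=u,\quad \alpha\cdot 1=1,\quad 1^u=1.$$ Assume that $(\alpha,u)\mapsto\alpha^u$ is strongly coconfluent. Put on $U\times A$ the multiplication $(u,\alpha)(v,\beta)=(u(\alpha\cdot v),\ \alpha^v\beta)$, which makes $U\times A$ a monoid. Then $U\times A$ has least common left multiples. Further, for $(u,\theta)$ and $(v,\phi)$ in $U\times A$ having a common left multiple, a least common left multiple $(r,\alpha)(u,\theta)=(s,\beta)(v,\phi)$ of $(u,\theta)$ and $(v,\phi)$ in $U\times A$ can be constructed so that $r(\alpha\cdot u)=s(\beta\cdot v)$ is a least common left multiple of $\alpha\cdot u$ and $\beta\cdot v$ in $U$. Lastly, if $U\times A$ is cancellative (for example, if $\alpha^u=\beta^u$ always implies $\alpha=\beta$), then any least common left multiple $(r,\alpha)(u,\theta)=(s,\beta)(v,\phi)$ of $(u,\theta)$ and $(v,\phi)$ in $U\times A$ has the property that $r(\alpha\cdot u)=s(\beta\cdot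 v)$ is a least common left multiple of $\alpha\cdot u$ and $\beta\cdot v$ in $U$.
   Context: Cancellative means both left and right cancellative. In a semigroup $S$, a common left multiple of $a,b$ is an element of the form $pa=qb$ with $p,q\in S$. A least common left multiple of $a,b$ is a common left multiple $pa=qb$ such that if $m$ is another common left multiple of $a$ and $b$, then there is a $k\in S$ with $m=kpa=kqb$. $S$ has least common left multiples if every pair $a,b$ that has a common left multiple has a least common left multiple (pairs without common left multiples are allowed). $(\alpha,u)\mapsto\alpha^u$ is strongly coconfluent if whenever $\alpha^u=\beta^v$ (with $\alpha,\beta\in A$, $u,v\in U$) and $u$ and $v$ have a common left multiple, there are $\gamma\in A$ and $p,q\in U$ such that $\alpha=\gamma^p$, $\beta=\gamma^q$ and $pu=qv$. *)

(* Defs.v *)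
From HB Require Import structures.
From mathcomp Require Import all_boot.

Set Implicit Arguments.
Unset Strict Implicit.
Unset Printing Implicit Defensive.

Local Open Scope group_scope.

Definition cancellative (S : monoidType) : Prop :=
  right_injective (@mul S) /\ left_injective (@mul S).

Definition have_common_left_multiple (S : monoidType) (a b : S) : Prop :=
  exists p q : S, p * a = q * b.

(* The multiple itself is p * a = q * b; the cofactors p and q are kept
   as arguments so that the equation is part of the notion. *)
Definition is_least_common_left_multiple (S : monoidType) (a b p q : S) : Prop :=
  p * a = q * b /\
  forall m : S, (exists p' q' : S, m = p' * a /\ m = q' * b) ->
    exists k : S, m = k * (p * a) /\ m = k * (q * b).

Definition has_least_common_left_multiples (S : monoidType) : Prop :=
  forall a b : S, have_common_left_multiple a b ->
    exists p q : S, is_least_common_left_multiple a b p q.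

(* act a u stands for a . u, and pow a u for a ^ u. *)
Record zappa_szep (U : monoidType) (A : groupType)
    (act : A -> U -> U) (pow : A -> U -> A) : Prop := ZappaSzep {
  zs_actM : forall a b u, act (a * b) u = act a (act b u);
  zs_powMl : forall a b u, pow (a * b) u = pow a (act b u) * pow b u;
  zs_actMr : forall a u v, act a (u * v) = act a u * act (pow a u) v;
  zs_powM : forall a u v, pow a (u * v) = pow (pow a u) v;
  zs_pow1 : forall a, pow a 1 = a;
  zs_act1l : forall u, act 1 u = u;
  zs_act1 : forall a, act a 1 = 1;
  zs_pow1l : forall u, pow 1 u = 1
}.

Definition strongly_coconfluent (U : monoidType) (A : groupType)
    (pow : A -> U -> A) : Prop :=
  forall (a b : A) (u v : U),
    pow a u = pow b v -> have_common_left_multiple u v ->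
    exists (c : A) (p q : U), [/\ a = pow c p, b = pow c q & p * u = q * v].

(* An alias of U * A, so that the twisted multiplication below does not clash
   with any componentwise structure on pairs. *)
Definition zs_prod (U : monoidType) (A : groupType)
    (act : A -> U -> U) (pow : A -> U -> A) (_ : zappa_szep act pow) : Type :=
  (U * A)%type.

Section ZsMonoid.
Variables (U : monoidType) (A : groupType).
Variables (act : A -> U -> U) (pow : A -> U -> A) (H : zappa_szep act pow).

Definition zs_mul (x y : zs_prod H) : zs_prod H :=
  (x.1 * act x.2 y.1, pow x.2 y.1 * y.2).

Definition zs_one : zs_prod H := (1, 1).

Fact zs_mulA : associative zs_mul.
Proof.
move=> [u a] [v b] [w c]; rewrite /zs_mul /=; congr (_, _).
  by rewrite (zs_actMr H) (zs_actM H) mulgA.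
by rewrite (zs_powM H) (zs_powMl H) mulgA.
Qed.

Fact zs_mul1 : left_id zs_one zs_mul.
Proof.
by move=> [u a]; rewrite /zs_mul /= (zs_act1l H) (zs_pow1l H) !mul1g.
Qed.

Fact zs_mulr1 : right_id zs_one zs_mul.
Proof.
by move=> [u a]; rewrite /zs_mul /= (zs_act1 H) (zs_pow1 H) !mulg1.
Qed.

HB.instance Definition _ := Choice.copy (zs_prod H) (U * A)%type.
HB.instance Definition _ :=
  isMonoid.Build (zs_prod H) zs_mulA zs_mul1 zs_mulr1.

End ZsMonoid.

(* Main.v *)
(** Left multiplication by the units [(1, alpha)] reduces the problem to elements
    [(u, w)] and [(v, w)] of [U x A] with the same second component. For these, a
    least common left multiple [r u = s v] in [U] gives the least common left
    multiple [(r, 1)(u, w) = (s, 1)(v, w)]: strong coconfluence writes the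
    [A]-parts of the cofactors of any other common multiple as [xi ^ r] and
    [xi ^ s], and the action of [xi] maps least common left multiples to least
    common left multiples. *)

Require Import Defs.
From HB Require Import structures.
From mathcomp Require Import all_boot.

Set Implicit Arguments.
Unset Strict Implicit.
Unset Printing Implicit Defensive.

Local Open Scope group_scope.

Lemma cancellative_mulg_eq1C (S : monoidType) (a b : S) :
  cancellative S -> a * b = 1 -> b * a = 1.
Proof.
by move=> [_ injr] ab1; apply: (injr b); rewrite -mulgA ab1 mulg1 mul1g.
Qed.

Lemma lclm_common_multiple (S : monoidType) (a b p q : S) :
  p * a = q * b ->
  (forall p' q' : S, p' * a = q' * b -> exists k : S, p' * a = k * (p * a)) ->
  is_least_common_left_multiple a b p q.
Proof.
move=> eq_pq lpq; split=> // m [p' [q' [-> eq_pq']]].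
by have [k ->] := lpq _ _ eq_pq'; exists k; rewrite -eq_pq.
Qed.

(** Since [p' * a = (p' * w') * (w * a)], and likewise for [b], passing to [w * a] and [x * b]
    leaves the set of common left multiples unchanged. *)
Lemma lclm_mul_unit (S : monoidType) (w w' x x' a b p q : S) :
  w' * w = 1 -> x' * x = 1 ->
  is_least_common_left_multiple (w * a) (x * b) p q <->
  is_least_common_left_multiple a b (p * w) (q * x).
Proof.
move=> w'w x'x; split=> -[eq_pq lpq].
  rewrite !mulgA in eq_pq; split=> // m [p' [q' [def_p def_q]]].
  have [|k [mp mq]] := lpq m.
    exists (p' * w'), (q' * x'); split.
      by rewrite -mulgA (mulgA w') w'w mul1g.
    by rewrite -mulgA (mulgA x') x'x mul1g.
  by exists k; rewrite -(mulgA p) -(mulgA q).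
split=> [|m [p' [q' [def_p def_q]]]]; first by rewrite !mulgA.
have [|k [mp mq]] := lpq m; last by exists k; rewrite (mulgA p) (mulgA q).
by exists (p' * w), (q' * x); rewrite -!mulgA.
Qed.

Section ZappaSzep.

Variables (U : monoidType) (A : groupType).
Variables (act : A -> U -> U) (pow : A -> U -> A).
Hypothesis cancU : cancellative U.
Hypothesis H : zappa_szep act pow.

Let V := zs_prod H.

Lemma zs_mulE (u v : U) (a b : A) :
  ((u, a) : V) * (v, b) = (u * act a v, pow a v * b).
Proof. by []. Qed.

Lemma zs_actK (a : A) : cancel (act a) (act a^-1).
Proof. by move=> u; rewrite -(zs_actM H) mulVg (zs_act1l H). Qed.

Lemma zs_actVK (a : A) : cancel (act a^-1) (act a).
Proof. by move=> u; rewrite -(zs_actM H) mulgV (zs_act1l H). Qed.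

Lemma zs_unitV (a : A) : ((1, a^-1) : V) * (1, a) = 1.
Proof. by rewrite zs_mulE (zs_act1 H) (zs_pow1 H) mulVg mulg1. Qed.

Lemma zs_mul_split (r : U) (a : A) : ((r, a) : V) = ((r, 1) : V) * (1, a).
Proof. by rewrite zs_mulE (zs_act1 H) (zs_pow1 H) mulg1 mul1g. Qed.

Lemma zs_unit_mul (u : U) (a b : A) :
  ((1, a) : V) * (u, b) = (act a u, pow a u * b).
Proof. by rewrite zs_mulE mul1g. Qed.

Hypothesis lclmU : has_least_common_left_multiples U.

(* Acting by [x^-1] on a least multiple of the images produces a common multiple
   of [u] and [v] that left-divides [r u]; minimality of [r u] makes the quotient
   a unit. *)
Lemma lclm_act (x : A) (u v r s : U) :
  is_least_common_left_multiple u v r s ->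
  is_least_common_left_multiple (act (pow x r) u) (act (pow x s) v)
    (act x r) (act x s).
Proof.
have [injl injr] := cancU; move=> [eq_rs lrs].
have eq_act : act x r * act (pow x r) u = act x s * act (pow x s) v.
  by rewrite -!(zs_actMr H) eq_rs.
have [|p [q [eq_pq lpq]]] := @lclmU (act (pow x r) u) (act (pow x s) v).
  by exists (act x r), (act x s).
have [|t [tp tq]] := lpq (act x r * act (pow x r) u).
  by exists (act x r), (act x s).
have {tp} def_r : act x r = t * p.
  by apply: (injr (act (pow x r) u)); rewrite /= tp mulgA.
have {tq} def_s : act x s = t * q.
  by apply: (injr (act (pow x s) v)); rewrite /= -eq_act tq mulgA.
(* Applying [x^-1] to [t * p] and [t * q] splits the same left factor [t'] off [r] and [s], with [y]
   acting on the rest. *)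
pose t' := act x^-1 t; pose y := pow x^-1 t.
have r_eq : r = t' * act y p by rewrite -(zs_actMr H) -def_r zs_actK.
have s_eq : s = t' * act y q by rewrite -(zs_actMr H) -def_s zs_actK.
have eq_y : act y p * u = act y q * v.
  by apply: (injl t'); rewrite !mulgA -r_eq -s_eq.
have [|k [def_k _]] := lrs (act y p * u).
  by exists (act y p), (act y q).
have kt'1 : k * t' = 1.
  apply: (injr (act y p * u)).
  by rewrite mul1g {2}def_k r_eq -!mulgA.
have := cancellative_mulg_eq1C cancU kt'1.
(* Acting by [x] on [t' * k = 1] carries invertibility from [t'] back to [t], because
   [act x t' = t]. *)
move/(congr1 (act x)); rewrite (zs_act1 H) (zs_actMr H) zs_actVK => tk1.
have {}tk1 := cancellative_mulg_eq1C cancU tk1.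
apply: lclm_common_multiple => // p' q' eq_pq'.
have [|h [-> _]] := lpq (p' * act (pow x r) u); first by exists p', q'.
exists (h * act (pow x t') k).
by rewrite def_r -!mulgA (mulgA _ t) tk1 mul1g.
Qed.

Hypothesis scc : strongly_coconfluent pow.

Lemma zs_lclm_same (u v r s : U) (w : A) :
  is_least_common_left_multiple u v r s ->
  is_least_common_left_multiple ((u, w) : V) (v, w) (r, 1) (s, 1).
Proof.
move=> lrs; have [eq_rs leq_rs] := lrs; have [_ injr] := cancU.
apply: lclm_common_multiple => [|[p a] [q b]].
  by rewrite !zs_mulE !(zs_act1l H) !(zs_pow1l H) eq_rs.
rewrite !zs_mulE => -[eq_pq /mulIg eq_ab].
have [|c [i [j [def_a def_b eq_ij]]]] := scc eq_ab; first by exists r, s.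
have [|k [ik jk]] := leq_rs (i * u); first by exists i, j.
have {ik} def_i : i = k * r by apply: (injr u); rewrite /= ik mulgA.
have {jk} def_j : j = k * s by apply: (injr v); rewrite /= -eq_ij jk mulgA.
(* As [i = k * r] and [j = k * s], the common factor [k] is absorbed into the base:
   [c ^ (k r) = (c ^ k) ^ r]. *)
pose x := pow c k.
have {def_i}def_a : a = pow x r by rewrite def_a def_i (zs_powM H).
have {def_j}def_b : b = pow x s by rewrite def_b def_j (zs_powM H).
have [_ lx] := lclm_act x lrs.
have [|h [def_h _]] := lx (p * act a u).
  by exists p, q; rewrite -def_a -def_b.
(* The [A]-component agrees because [x ^ (r u) = (x ^ r) ^ u = a ^ u]. *)
exists (h, x).
rewrite !zs_mulE (zs_act1l H) (zs_pow1l H) mul1g (zs_actMr H) (zs_powM H).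
by rewrite def_h -def_a.
Qed.

(** Writing [(r, alpha) = (r, 1)(1, alpha)] moves the unit onto [(u, theta)], and similarly for
    [beta]; the hypothesis makes the new second components equal. *)
Lemma zs_lclm_unit (u v r s : U) (theta phi alpha beta : A) :
  pow alpha u * theta = pow beta v * phi ->
  is_least_common_left_multiple ((u, theta) : V) (v, phi)
    (r, alpha) (s, beta) <->
  is_least_common_left_multiple
    ((act alpha u, pow alpha u * theta) : V)
    (act beta v, pow alpha u * theta) (r, 1) (s, 1).
Proof.
move=> eqA; rewrite {2}eqA -!zs_unit_mul (zs_mul_split r) (zs_mul_split s).
by apply: iff_sym; apply: lclm_mul_unit; apply: zs_unitV.
Qed.

Lemma zs_lclm_construct (u v : U) (theta phi : A) :
  have_common_left_multiple ((u, theta) : V) (v, phi) ->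
  exists (r s : U) (alpha beta : A),
    is_least_common_left_multiple ((u, theta) : V) (v, phi)
      (r, alpha) (s, beta) /\
    is_least_common_left_multiple (act alpha u) (act beta v) r s.
Proof.
move=> [[p a] [[q b]]]; rewrite !zs_mulE => -[eqU eqA].
(* The [A]-parts [a], [b] of any given pair of cofactors are kept; only the [U]-parts are replaced
   by least ones. *)
have [|r [s lrs]] := @lclmU (act a u) (act b v); first by exists p, q.
exists r, s, a, b; split=> //.
by apply/(zs_lclm_unit _ _ eqA); apply: zs_lclm_same.
Qed.

(** Left cancellation rests on the bijectivity of [act a]. On the right, injectivity of the power
    map identifies the [A]-parts first, and then [U] cancels. *)
Lemma zs_cancellative :
  (forall (a b : A) (u : U), pow a u = pow b u -> a = b) -> cancellative V.
Proof.
have [injl injr] := cancU.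
move=> inj_pow; split=> [[u a] [v b] [w c]|[u a] [v b] [w c]] /=.
  by rewrite !zs_mulE => -[/injl/(can_inj (zs_actK a))-> /mulgI->].
by rewrite !zs_mulE => -[+ /mulIg/inj_pow eq_bc]; rewrite eq_bc => /injr->.
Qed.

(** A least multiple [p * u] in [U] gives [r = t * p]. It lifts to a common multiple in [V], so
    minimality there makes [(t, 1)], hence [t], invertible. *)
Lemma zs_lclm_same_inv (u v r s : U) (w : A) :
  cancellative V ->
  is_least_common_left_multiple ((u, w) : V) (v, w) (r, 1) (s, 1) ->
  is_least_common_left_multiple u v r s.
Proof.
move=> cancV [eqV lV]; have [_ injr] := cancU; have [_ injrV] := cancV.
have eq_rs : r * u = s * v.
  by move: eqV; rewrite !zs_mulE !(zs_act1l H) => -[].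
have [|p [q lpq]] := @lclmU u v; first by exists r, s.
have [eq_pq leq_pq] := lpq.
have [|t [def_t _]] := leq_pq (r * u); first by exists r, s.
have {def_t} def_r : r = t * p by apply: (injr u); rewrite /= def_t mulgA.
have [eqVpq _] := zs_lclm_same w lpq.
have [|[y b] [def_y _]] := lV (((p, 1) : V) * (u, w)).
  by exists (p, 1), (q, 1).
have rV : ((r, 1) : V) = ((t, 1) : V) * (p, 1).
  by rewrite zs_mulE (zs_act1l H) (zs_pow1l H) mulg1 def_r.
have yt1 : ((y, b) : V) * (t, 1) = 1.
  apply: (injrV (((p, 1) : V) * (u, w))) => /=.
  by rewrite mul1g {2}def_y rV -!mulgA.
(* In the reversed product [(t, 1)(y, b)] the action is by [1], so its [U]-component is plainly
   [t * y]. *)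
have := cancellative_mulg_eq1C cancV yt1.
rewrite zs_mulE (zs_act1l H) => -[ty1 _].
have {}yt1 := cancellative_mulg_eq1C cancU ty1.
apply: lclm_common_multiple => // p' q' eq_pq'.
have [|k [-> _]] := leq_pq (p' * u); first by exists p', q'.
by exists (k * y); rewrite def_r -!mulgA (mulgA y) yt1 mul1g.
Qed.

End ZappaSzep.

Theorem lemma3p14 (U : monoidType) (A : groupType)
    (act : A -> U -> U) (pow : A -> U -> A)
    (cancU : cancellative U)
    (lclmU : has_least_common_left_multiples U)
    (H : zappa_szep act pow)
    (scc : strongly_coconfluent pow) :
  [/\ has_least_common_left_multiples (zs_prod H),
      forall (u v : U) (theta phi : A),
        have_common_left_multiple ((u, theta) : zs_prod H) (v, phi) ->
        exists (r s : U) (alpha beta : A),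
          is_least_common_left_multiple ((u, theta) : zs_prod H) (v, phi)
            (r, alpha) (s, beta) /\
          is_least_common_left_multiple (act alpha u) (act beta v) r s,
      (forall (alpha beta : A) (u : U), pow alpha u = pow beta u ->
         alpha = beta) ->
      cancellative (zs_prod H) &
      cancellative (zs_prod H) ->
      forall (u v r s : U) (theta phi alpha beta : A),
        is_least_common_left_multiple ((u, theta) : zs_prod H) (v, phi)
          (r, alpha) (s, beta) ->
        is_least_common_left_multiple (act alpha u) (act beta v) r s].
Proof.
split.
- move=> [u theta] [v phi] /(zs_lclm_construct cancU lclmU scc).
  by move=> [r [s [a [b [lV _]]]]]; exists (r, a), (s, b).
- exact: zs_lclm_construct.
- exact: zs_cancellative.
move=> cancV u v r s theta phi alpha beta lV.
have eqA : pow alpha u * theta = pow beta v * phi.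
  by have [+ _] := lV; rewrite !zs_mulE => -[].
by move/(zs_lclm_unit H _ _ eqA): lV; apply: zs_lclm_same_inv.
Qed.
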